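(* Let $\mathcal A$ and $\mathcal B$ be ideals of closed subsets of a topological space $X$. If $X$ is $\mathcal A$-normal and $\mathcal B$ consists of sequentially compact sets, then $$\mathsf G_1(\mathscr{N}_X[\mathcal A], \neg \Lambda_X(\mathcal B)) \leq_{\mathrm{II}} \mathsf G_1(\mathscr{T}_{MU_{\mathcal A}(X)}, \mathrm{CD}_{MU_{\mathcal B}(X)}).$$ Consequently, $$\mathsf G_1(\mathscr N_X[\mathcal A], \neg \mathcal O_X(\mathcal B)) \equiv \mathsf G_1(\mathscr N_{MU_{\mathcal A}(X),\mathbf 0}, \neg \Omega_{MU_{\mathcal B}(X),\mathbf 0}) \equiv \mathsf G_1(\mathscr T_{MU_{\mathcal A}(X)}, \neg \Omega_{MU_{\mathcal B}(X),\mathbf 0}) \equiv \mathsf G_1(\mathscr{T}_{MU_{\mathcal A}(X)}, \mathrm{CD}_{MU_{\mathcal B}(X)}).$$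
   Context: Games. For collections $\mathcal P,\mathcal Q$ of sets, in the game $\mathsf G_1(\mathcal P,\mathcal Q)$, at round $n\in\omega$ One chooses $P_n\in\mathcal P$ and Two responds with $x_n\in P_n$; Two wins if $\{x_n:n\in\omega\}\in\mathcal Q$, otherwise One wins. $\neg\mathcal Q$ denotes the collection of sets not in $\mathcal Q$. A strategy for One is $\sigma:(\bigcup\mathcal P)^{<\omega}\to\mathcal P$; it is winning if $\{x_n:n\in\omega\}\notin\mathcal Q$ whenever $x_n\in\sigma\langle x_k:k<n\rangle$ for all $n$; $\mathrm I\uparrow$ means One has a winning strategy. A strategy for Two is $\tau:\mathcal P^{<\omega}\to\bigcup\mathcal P$ (giving legal moves); it is winning if $\{\tau(P_0,\dots,P_n):n\in\omega\}\in\mathcal Q$ for all $(P_n)\in\mathcal P^\omega$; $\mathrm{II}\uparrow$ means Two has a winning strategy. A predetermined strategy for One is a function $\omega\to\mathcal P$ (depends only on the round); $\mathrm I\underset{\mathrm{pre}}{\uparrow}$ means One has a winning one. A Markov strategy for Two is a function $\mathcal P\times\omega\to\bigcup\mathcal P$ (depends only on One's latest move and the round); $\mathrm{II}\underset{\mathrm{mark}}{\uparrow}$ means Two has a winning one. For games $\mathcal G,\mathcal H$ of this type, $\mathcal G\leq_{\mathrm{II}}\mathcal H$ means that all four implications hold: $\mathrm{II}\underset{\mathrm{mark}}{\uparrow}\mathcal G\Rightarrow\mathrm{II}\underset{\mathrm{mark}}{\uparrow}\mathcal H$; $\mathrm{II}\uparrow\mathcal G\Rightarrow\mathrm{II}\uparrow\mathcal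 H$; $\mathrm I\not\uparrow\mathcal G\Rightarrow\mathrm I\not\uparrow\mathcal H$; $\mathrm I\underset{\mathrm{pre}}{\not\uparrow}\mathcal G\Rightarrow\mathrm I\underset{\mathrm{pre}}{\not\uparrow}\mathcal H$. $\mathcal G\equiv\mathcal H$ (equivalence) means the four corresponding biconditionals hold. Ideals and covers. An ideal of closed subsets of $X$ is a family $\mathcal A$ of non-empty closed subsets of $X$, closed under unions of two members and containing $\{x\}$ for every $x\in X$; throughout, $X\notin\mathcal A$ is assumed for every ideal of closed sets. $X$ is $\mathcal A$-normal if for every $A\in\mathcal A$ and open $U\supseteq A$ there is an open $V$ with $A\subseteq V\subseteq\mathrm{cl}(V)\subseteq U$. A subset $B$ of a space is sequentially compact if every sequence in $B$ has a subsequence converging to a point of $B$. $\mathcal O_X(\mathcal A)$ is the set of $\mathcal A$-covers: open covers $\mathscr U$ of $X$ with $\emptyset,X\notin\mathscr U$ such that every $A\in\mathcal A$ is contained in some $U\in\mathscr U$. $\Lambda_X(\mathcal A)$ is the set of $\mathcal A$-covers $\mathscr U$ such that $\{U\in\mathscr U:A\subseteq U\}$ is infinite for every $A\in\mathcal A$. For a space $Z$: $\mathscr T_Z$ is the family of proper non-empty open subsets of $Z$; $\mathscr N_{Z,z}=\{U\in\mathscr T_Z:z\in U\}$; $\mathscr N_Z(A)=\{U\in\mathscr T_Z:A\subseteq U\}$; $\mathscr N_Z[\mathcal A]=\{\mathscr N_Z(A):A\in\mathcal A\}$; $\Omega_{Z,z}=\{S\subseteq Z: z\in\mathrm{cl}(S)\}$;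 $\mathrm{CD}_Z$ is the set of closed discrete subsets of $Z$. Minimal usco maps. An usco map $\Phi$ from $X$ to $\mathbb R$ assigns to each $x\in X$ a non-empty compact set $\Phi(x)\subseteq\mathbb R$ so that $\{x:\Phi(x)\subseteq V\}$ is open for every open $V\subseteq\mathbb R$; it is minimal if its graph $\{(x,y):y\in\Phi(x)\}$ is $\subseteq$-minimal among graphs of usco maps from $X$ to $\mathbb R$. $MU(X)$ is the set of minimal usco maps from $X$ to $\mathbb R$. For $\Phi\in MU(X)$, $A\subseteq X$, $\varepsilon>0$, $[\Phi;A,\varepsilon]$ is the set of $\Psi\in MU(X)$ such that for all $x\in A$ each point of $\Phi(x)$ is within distance $<\varepsilon$ of some point of $\Psi(x)$ and each point of $\Psi(x)$ is within distance $<\varepsilon$ of some point of $\Phi(x)$. $MU_{\mathcal A}(X)$ is $MU(X)$ with the topology in which $O$ is open iff for each $\Phi\in O$ there are $A\in\mathcal A$, $\varepsilon>0$ with $[\Phi;A,\varepsilon]\subseteq O$. $\mathbf 0\in MU(X)$ is the constant map $x\mapsto\{0\}$. *)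

(* Defs.v *)
(* Library world: MathComp-Analysis. *)
From Stdlib Require List.
From HB Require Import structures.
From mathcomp Require Import all_boot all_order all_algebra.
From mathcomp Require Import all_classical all_reals all_analysis.

Set Implicit Arguments.
Unset Strict Implicit.
Unset Printing Implicit Defensive.

Import Order.TTheory GRing.Theory Num.Theory.
Import numFieldNormedType.Exports.

Local Open Scope classical_set_scope.
Local Open Scope ring_scope.

(** * Selection games *)

(* [G1 P Q] is the game G_1(P, Q).  The members of [P] and of [Q] are subsets of
   an ambient type [T], which the union of [P] need not exhaust. *)
Record game (T : Type) := G1 { moves : set (set T) ; payoff : set (set T) }.

Section Strategies.
Context {T : Type}.
Implicit Type G : game T.

(* Strategies are total functions; only their values on legal histories are
   constrained or used. *)

Definition One_strategy G (sigma : seq T -> set T) : Prop :=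
  forall s : seq T, List.Forall (\bigcup_(P in moves G) P) s ->
    moves G (sigma s).

Definition One_wins G : Prop :=
  exists2 sigma : seq T -> set T, One_strategy G sigma &
    forall x : nat -> T,
      (forall n, sigma (mkseq x n) (x n)) -> ~ payoff G (range x).

Definition One_wins_pre G : Prop :=
  exists2 sigma : nat -> set T, (forall n, moves G (sigma n)) &
    forall x : nat -> T,
      (forall n, sigma n (x n)) -> ~ payoff G (range x).

(* [tau (mkseq P n.+1)] is Two's answer to One's moves P 0, ..., P n. *)
Definition Two_strategy G (tau : seq (set T) -> T) : Prop :=
  forall (s : seq (set T)) (P : set T),
    List.Forall (moves G) s -> moves G P -> P (tau (rcons s P)).

Definition Two_wins G : Prop :=
  exists2 tau : seq (set T) -> T, Two_strategy G tau &
    forall P : nat -> set T, (forall n, moves G (P n)) ->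
      payoff G (range (fun n => tau (mkseq P n.+1))).

Definition Two_wins_mark G : Prop :=
  exists2 tau : set T -> nat -> T,
    (forall P n, moves G P -> P (tau P n)) &
    forall P : nat -> set T, (forall n, moves G (P n)) ->
      payoff G (range (fun n => tau (P n) n)).

End Strategies.

Definition game_le_II {T U : Type} (G : game T) (H : game U) : Prop :=
  [/\ Two_wins_mark G -> Two_wins_mark H,
      Two_wins G -> Two_wins H,
      ~ One_wins G -> ~ One_wins H &
      ~ One_wins_pre G -> ~ One_wins_pre H].

Definition game_equiv {T U : Type} (G : game T) (H : game U) : Prop :=
  [/\ Two_wins_mark G <-> Two_wins_mark H,
      Two_wins G <-> Two_wins H,
      ~ One_wins G <-> ~ One_wins H &
      ~ One_wins_pre G <-> ~ One_wins_pre H].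

(** * Families of open sets *)

Section Families.
Variable Z : topologicalType.

Definition proper_opens : set (set Z) :=
  [set U | [/\ open U, U !=set0 & U <> setT]].

Definition proper_opens_at (z : Z) : set (set Z) :=
  [set U | proper_opens U /\ U z].

Definition proper_opens_over (A : set Z) : set (set Z) :=
  [set U | proper_opens U /\ A `<=` U].

Definition Omega_at (z : Z) : set (set Z) := [set S | closure S z].

Definition closed_discrete : set (set Z) :=
  [set S | closed S /\ S `<=` isolated S].

Definition sequentially_compact (B : set Z) : Prop :=
  forall u : nat -> Z, (forall n, B (u n)) ->
    exists phi : nat -> nat,
      increasing_seq phi /\ exists2 z, B z & (u \o phi) @ \oo --> z.

End Families.
Arguments proper_opens : clear implicits.
Arguments proper_opens_at : clear implicits.
Arguments proper_opens_over : clear implicits.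
Arguments Omega_at : clear implicits.
Arguments closed_discrete : clear implicits.

(** * Ideals of closed sets *)

Record closed_ideal (X : topologicalType) := ClosedIdeal {
  ideal_sets :> set (set X) ;
  ideal_closed : forall A, ideal_sets A -> closed A ;
  ideal_nonempty : forall A, ideal_sets A -> A !=set0 ;
  ideal_setU : forall A B,
    ideal_sets A -> ideal_sets B -> ideal_sets (A `|` B) ;
  ideal_set1 : forall x, ideal_sets [set x] ;
  ideal_proper : ~ ideal_sets setT
}.

Section Covers.
Variable X : topologicalType.
Implicit Type A : set (set X).

Definition ideal_normal A : Prop :=
  forall S U, A S -> open U -> S `<=` U ->
    exists V, [/\ open V, S `<=` V & closure V `<=` U].

Definition proper_opens_over_members A : set (set (set X)) :=
  [set proper_opens_over X S | S in A].

Definition ideal_covers A : set (set (set X)) :=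
  [set C | [/\ forall U, C U -> open U,
               \bigcup_(U in C) U = setT,
               ~ C set0,
               ~ C setT &
               forall S, A S -> exists2 U, C U & S `<=` U]].

Definition large_covers A : set (set (set X)) :=
  [set C | ideal_covers A C /\
    forall S, A S -> infinite_set [set U | C U /\ S `<=` U]].

End Covers.

(** * Minimal usco maps *)

Section MinimalUsco.
Variables (R : realType) (X : topologicalType).

Definition usco (Phi : X -> set R) : Prop :=
  [/\ forall x, Phi x !=set0,
      forall x, compact (Phi x) &
      forall V : set R, open V -> open [set x | Phi x `<=` V]].

Definition graph (Phi : X -> set R) : set (X * R) :=
  [set p | Phi p.1 p.2].

Definition minimal_usco (Phi : X -> set R) : Prop :=
  usco Phi /\
  forall Psi, usco Psi -> graph Psi `<=` graph Phi -> graph Psi = graph Phi.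

Record MU := MkMU {
  MU_map :> X -> set R ;
  MU_minimal : minimal_usco MU_map
}.

Definition MU_nbhd (Phi : MU) (A : set X) (eps : R) : set MU :=
  [set Psi | forall x, A x ->
    (forall y, Phi x y -> exists2 z, Psi x z & `|y - z| < eps) /\
    (forall z, Psi x z -> exists2 y, Phi x y & `|z - y| < eps)].

Lemma minimal_usco0 : minimal_usco (fun _ : X => [set (0 : R)]).
Proof.
split; first split.
- by move=> _; exists 0.
- by move=> _; exact: compact_set1.
- move=> V _; have [V0|V0] := pselect (V 0).
    rewrite (_ : [set _ | _] = setT); first exact: openT.
    by apply/seteqP; split=> // x _ _ ->.
  rewrite (_ : [set _ | _] = set0); first exact: open0.
  by apply/seteqP; split=> // x /(_ 0 erefl).
- move=> Psi [Psi0 _ _] sub; apply/seteqP; split=> // -[x y] y0.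
  have [z Pz] := Psi0 x; have z0 : z = 0 := sub (x, z) Pz.
  by rewrite /graph /= (y0 : y = 0) -z0.
Qed.

Definition MU0 : MU := MkMU minimal_usco0.

(* The disjunct [O = setT] is redundant as soon as [X] has a point.  It is there
   for the empty space, whose only ideal is the empty family. *)
Definition MU_open (A : closed_ideal X) (O : set MU) : Prop :=
  O = setT \/
  forall Phi, O Phi -> exists S (eps : R),
    [/\ ideal_sets A S, 0 < eps & MU_nbhd Phi S eps `<=` O].

Lemma MU_open_inhab (A : closed_ideal X) (O : set MU) (x : X) :
  MU_open A O <->
  forall Phi, O Phi -> exists S (eps : R),
    [/\ ideal_sets A S, 0 < eps & MU_nbhd Phi S eps `<=` O].
Proof.
split=> [[-> Phi _|//]|]; last by right.
by exists [set x], 1; split=> //; exact: ideal_set1.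
Qed.

Lemma MU_nbhdS (Phi : MU) (S S' : set X) (e e' : R) :
  S `<=` S' -> e' <= e -> MU_nbhd Phi S' e' `<=` MU_nbhd Phi S e.
Proof.
move=> SS' ee' Psi PsiP x /SS' /PsiP [h1 h2]; split=> y.
  by move=> /h1[z ? lt]; exists z => //; exact: lt_le_trans lt ee'.
by move=> /h2[z ? lt]; exists z => //; exact: lt_le_trans lt ee'.
Qed.

Lemma MU_openT (A : closed_ideal X) : MU_open A setT.
Proof. by left. Qed.

Lemma MU_openI (A : closed_ideal X) : setI_closed (MU_open A).
Proof.
move=> O1 O2 [->|h1]; first by rewrite setTI.
move=> [->|h2]; first by rewrite setIT; right.
right=> Phi [/h1[S1 [e1 [AS1 e10 sub1]]] /h2[S2 [e2 [AS2 e20 sub2]]]].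
exists (S1 `|` S2), (Num.min e1 e2); split.
- exact: ideal_setU.
- by rewrite lt_min e10.
- move=> Psi PsiP; split.
    apply: sub1; apply: MU_nbhdS PsiP; first exact: subsetUl.
    by rewrite ge_min lexx.
  apply: sub2; apply: MU_nbhdS PsiP; first exact: subsetUr.
  by rewrite ge_min lexx orbT.
Qed.

Lemma MU_open_bigU (A : closed_ideal X) (I : Type) (f : I -> set MU) :
  (forall i, MU_open A (f i)) -> MU_open A (\bigcup_i f i).
Proof.
move=> fo; have [[i fiT]|nT] := pselect (exists i, f i = setT).
  by left; apply/seteqP; split=> // Phi _; exists i; rewrite ?fiT.
right=> Phi [i _ fiPhi]; case: (fo i) => [fiT|/(_ _ fiPhi)].
  by case: nT; exists i.
move=> [S [e [AS e0 sub]]]; exists S, e; split=> //.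
by move=> Psi /sub ?; exists i.
Qed.

End MinimalUsco.
Arguments MU0 : clear implicits.

Definition MUspace (R : realType) (X : topologicalType) (A : closed_ideal X)
  : Type := MU R X.

HB.instance Definition _ (R : realType) (X : topologicalType)
  (A : closed_ideal X) := gen_eqMixin (MUspace R A).
HB.instance Definition _ (R : realType) (X : topologicalType)
  (A : closed_ideal X) := gen_choiceMixin (MUspace R A).
HB.instance Definition _ (R : realType) (X : topologicalType)
  (A : closed_ideal X) :=
  @isOpenTopological.Build (MUspace R A) (@MU_open R X A)
    (@MU_openT R X A) (@MU_openI R X A) (@MU_open_bigU R X A).

Lemma open_MUspaceE (R : realType) (X : topologicalType) (A : closed_ideal X)
  (O : set (MUspace R A)) : open O = MU_open A O.
Proof. by []. Qed.

(* Main.v *)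
Require Import Defs.
From HB Require Import structures.
From mathcomp Require Import all_boot all_order all_algebra.
From mathcomp Require Import all_classical all_reals all_analysis.

(** The games are compared in a cycle.  Writing [G <= H] for [game_le_II G H],

      large covers <= closed discrete <= opens, closure <= neighbourhoods of 0,
      closure <= covers <= large covers,

    and since [<=] is transitive, going round the cycle gives every equivalence.
    Each link is an instance of [game_le_II_of_answers]: One's move in the right
    hand game is turned into a move in the left hand game, and Two's answer
    there is turned back into a legal answer on the right, in a way that depends
    only on the current round.  Such a recipe carries strategies of all four
    kinds across.

    - From closed discrete sets to sets not accumulating at 0, a move [U] is
      replaced with [U] minus the point 0, which is still a legal move because
      MU(X) is T1 and 0 is not isolated.  A closed set that omits 0 does not
      accumulate at 0.
    - From open moves to neighbourhoods of 0, One merely loses moves.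
    - From neighbourhoods of 0 to covers, the move N(S) in round n becomes a
      neighbourhood inside [0; S, 1/(n+1)], and an answer Phi becomes the open
      set where Phi takes values of modulus below 1/(n+1), minus a point off S.
      If these sets formed a cover then each member of B would lie in infinitely
      many of them ([large_covers_ideal_covers]: an ideal without the whole
      space has only large covers), so 0 would be in the closure of the Phi's.
    - From large covers to closed discrete sets, an open move contains some
      [Phi; S, e] and becomes N(S).  An answer U is a proper open set around S,
      and normality provides a minimal usco map equal to Phi on S and to the
      constant n off U ([exists_usco_separating]).  When the sets U_n are not a
      cover, some T in B is inside none of them, so the n-th map takes the value
      n somewhere on T.  Minimal usco maps are locally bounded and T is
      sequentially compact, so no map has infinitely many of these maps close to
      it on T ([finite_near_diverging_values]): they are closed discrete. *)

Set Implicit Arguments.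
Unset Strict Implicit.
Unset Printing Implicit Defensive.
Import Order.TTheory GRing.Theory Num.Theory.
Import numFieldNormedType.Exports.

Local Open Scope classical_set_scope.
Local Open Scope ring_scope.

(** * Comparison of selection games *)

Lemma Forall_mkseq (T : Type) (P : T -> Prop) (x : nat -> T) n :
  (forall i, (i < n)%N -> P (x i)) -> List.Forall P (mkseq x n).
Proof.
elim: n => [|n IHn] Px /=; first exact: List.Forall_nil.
rewrite mkseqS -cats1; apply/List.Forall_app; split.
  by apply: IHn => i ltin; apply: Px; exact: ltnW.
by apply: List.Forall_cons; [exact: Px | exact: List.Forall_nil].
Qed.

(** Each of the four strategies is transported by playing both games side by
    side.  The translations of One's move and of Two's answer may depend on the
    round but not on the history, so they preserve limited-information
    strategies.  The point [y0] is a value for Two's translated answer in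
    positions that no play reaches. *)
Lemma game_le_II_of_answers (T U : Type) (G : game T) (H : game U) (y0 : U)
    (answer : nat -> T -> U -> Prop) :
    (forall n P, moves H P -> exists2 Q, moves G Q &
       forall x, Q x -> exists2 y, P y & answer n x y) ->
    (forall x y, (forall n, answer n (x n) (y n)) ->
       payoff G (range x) -> payoff H (range y)) ->
  game_le_II G H.
Proof.
move=> answerH payoffGH.
have [J JP] : {J : nat -> set U -> set T & forall n P, moves H P ->
    moves G (J n P) /\ forall x, J n P x -> exists2 y, P y & answer n x y}.
  have /choice[J JP] : forall nP : nat * set U, exists Q, moves H nP.2 ->
      moves G Q /\ forall x, Q x -> exists2 y, nP.2 y & answer nP.1 x y.
    move=> [n P]; have [HP|nHP] := pselect (moves H P); last by exists set0.
    by have [Q GQ QP] := answerH n P HP; exists Q.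
  by exists (fun n P => J (n, P)) => n P; exact: JP (n, P).
have JG n P : moves H P -> moves G (J n P) by case/(JP n).
have [r rP] : {r : nat -> set U -> T -> U & forall n P x, moves H P ->
    J n P x -> P (r n P x) /\ answer n x (r n P x)}.
  have /choice[r rP] : forall nPx : nat * set U * T, exists y,
      moves H nPx.1.2 -> J nPx.1.1 nPx.1.2 nPx.2 ->
      nPx.1.2 y /\ answer nPx.1.1 nPx.2 y.
    move=> [[n P] x] /=; have [[HP JPx]|nHJ] :=
      pselect (moves H P /\ J n P x); last by exists y0 => HP JPx; case: nHJ.
    by have [y Py ay] := (JP n P HP).2 x JPx; exists y.
  by exists (fun n P x => r (n, P, x)) => n P x; exact: rP (n, P, x).
split.
- move=> [tau tauG winG]; exists (fun P n => r n P (tau (J n P) n)).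
    by move=> P n HP; apply: (rP _ _ _ HP _).1; by apply: tauG; exact: JG.
  move=> P HP; apply: (payoffGH (fun n => tau (J n (P n)) n)).
    by move=> n; apply: (rP _ _ _ (HP n) _).2; by apply: tauG; exact: JG.
  by apply: (winG (fun n => J n (P n))) => n; exact: JG.
- move=> [tau tauG winG].
  pose JJ (s : seq (set U)) := mkseq (fun i => J i (nth set0 s i)) (size s).
  have JJ_rcons s P : JJ (rcons s P) = rcons (JJ s) (J (size s) P).
    rewrite /JJ size_rcons mkseqS nth_rcons ltnn eqxx; congr rcons.
    rewrite /mkseq; apply/eq_in_map => i; rewrite mem_iota => /andP[_ lti].
    by rewrite nth_rcons lti.
  have JJ_mkseq P n : JJ (mkseq P n) = mkseq (fun i => J i (P i)) n.
    elim: n => [//|n IHn]; rewrite !mkseqS JJ_rcons IHn size_mkseq.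
    by [].
  have JJG s : List.Forall (moves H) s -> List.Forall (moves G) (JJ s).
    elim/last_ind: s => [_|s P IHs]; first exact: List.Forall_nil.
    rewrite JJ_rcons -!cats1 => /List.Forall_app[/IHs Gs HP].
    apply/List.Forall_app; split=> //; apply: List.Forall_cons.
      by apply: JG; exact: (List.Forall_inv HP).
    exact: List.Forall_nil.
  exists (fun s => r (size s).-1 (last set0 s) (tau (JJ s))).
    move=> s P Hs HP; rewrite size_rcons last_rcons.
    apply: (rP _ _ _ HP _).1; rewrite JJ_rcons.
    by apply: tauG; [exact: JJG | exact: JG].
  move=> P HP.
  apply: (payoffGH (fun n => tau (mkseq (fun i => J i (P i)) n.+1)));
    last first.
    by apply: (winG (fun n => J n (P n))) => n; exact: JG.
  move=> n.
  rewrite size_mkseq (mkseqS P) last_rcons -(mkseqS P) JJ_mkseq [_.-1]/=.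
  apply: (rP _ _ _ (HP n) _).2; rewrite mkseqS.
  apply: tauG; last exact: JG.
  by apply: Forall_mkseq => i _; exact: JG.
- apply: contra_not => -[sigma sigmaH winH].
  (* [play s] is the list of translated answers to [s].  A history of legal
     choices that ignores the strategy may translate to an illegal one, where
     [sigma] is unconstrained; [sg] falls back on the opening move there. *)
  have H0 : moves H (sigma [::]) by apply: sigmaH; exact: List.Forall_nil.
  pose sg s := if `[< moves H (sigma s) >] then sigma s else sigma [::].
  have sgH s : moves H (sg s) by rewrite /sg; case: asboolP.
  pose play := foldl (fun t x => rcons t (r (size t) (sg t) x)) [::].
  have play_rcons s x : play (rcons s x) =
      rcons (play s) (r (size (play s)) (sg (play s)) x).
    by rewrite /play foldl_rcons.
  have size_play s : size (play s) = size s.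
    by elim/last_ind: s => // s x IHs; rewrite play_rcons !size_rcons IHs.
  exists (fun s => J (size s) (sg (play s))); first by move=> s _; exact: JG.
  move=> x xJ; pose y n := r n (sg (play (mkseq x n))) (x n).
  have play_mkseq n : play (mkseq x n) = mkseq y n.
    elim: n => // n IHn; rewrite mkseqS play_rcons IHn mkseqS size_mkseq.
    by rewrite /y -IHn.
  have ry n : sg (mkseq y n) (y n) /\ answer n (x n) (y n).
    rewrite /y -play_mkseq; apply: rP => //.
    by have := xJ n; rewrite size_mkseq.
  have sgE n : sg (mkseq y n) = sigma (mkseq y n).
    rewrite /sg; case: asboolP => // -[]; apply: sigmaH.
    by apply: Forall_mkseq => i _; exists (sg (mkseq y i)) => //; case: (ry i).
  move=> /(payoffGH x y); apply: contraPP => _.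
  move=> pH; apply: (winH y); last by apply: pH => n; case: (ry n).
  by move=> n; rewrite -sgE; case: (ry n).
- apply: contra_not => -[sigma sigmaH winH].
  exists (fun n => J n (sigma n)); first by move=> n; exact: JG.
  move=> x xJ Gx; have rx n := rP n _ _ (sigmaH n) (xJ n).
  apply: (winH (fun n => r n (sigma n) (x n))); first by move=> n; case: (rx n).
  by apply: payoffGH Gx => n; case: (rx n).
Qed.

Lemma game_le_II_same (T : Type) (G H : game T) (y0 : T) :
    moves H `<=` moves G -> payoff G `<=` payoff H -> game_le_II G H.
Proof.
move=> HG GH; apply: (game_le_II_of_answers y0 (answer := fun _ => eq)).
  by move=> _ P /HG GP; exists P => // x Px; exists x.
by move=> x y xy; rewrite (_ : y = x); [exact: GH | exact/funext].
Qed.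

Lemma game_le_II_trans (T U V : Type) (G : game T) (H : game U) (K : game V) :
  game_le_II G H -> game_le_II H K -> game_le_II G K.
Proof. by move=> [? ? ? ?] [? ? ? ?]; split; tauto. Qed.

Lemma game_equiv_le_II (T U : Type) (G : game T) (H : game U) :
  game_le_II G H -> game_le_II H G -> game_equiv G H.
Proof. by move=> [? ? ? ?] [? ? ? ?]; split; split. Qed.

(** * Minimal usco maps *)

(** If no [K i] were inside [W], the sets [K i `\` W] would generate a filter on
    a compact set, and a cluster point of it would be in every [K i] but not in
    [W]. *)
Lemma compact_chain_subset (T : topologicalType) (I : Type) (C : set I)
    (K : I -> set T) (W : set T) :
    hausdorff_space T -> open W -> C !=set0 ->
    (forall i, C i -> compact (K i)) ->
    (forall i j, C i -> C j -> K i `<=` K j \/ K j `<=` K i) ->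
    \bigcap_(i in C) K i `<=` W -> exists2 i, C i & K i `<=` W.
Proof.
move=> T2 oW [i0 Ci0] cK chainK capW; apply: contrapT => nKW.
have KDW0 i : C i -> (K i `\` W) !=set0.
  move=> Ci; apply: contrapT => /set0P/negP/negPn/eqP/subsets_disjoint KW.
  by apply: nKW; exists i => //; rewrite setCK in KW.
pose F := filter_from C (fun i => K i `\` W).
have FF : ProperFilter F.
  apply: filter_from_proper => //.
  apply: filter_from_filter; first by exists i0.
  move=> i j Ci Cj; have [ij|ji] := chainK i j Ci Cj; [exists i|exists j] => //.
    by move=> x [Kx nWx]; split; split=> //; exact: ij.
  by move=> x [Kx nWx]; split; split=> //; exact: ji.
have FK0 : F (K i0) by exists i0 => // x [].
have [p [_ clp]] := cK _ Ci0 F FF FK0.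
have Kp i : C i -> (K i `\` W) p.
  move=> Ci; have : closed (K i `\` W).
    apply: closedI; first exact: compact_closed (cK _ Ci).
    exact: open_closedC.
  by apply => V Vp; apply: clp => //; exists i.
by have [_] := Kp _ Ci0; apply; apply: capW => i /Kp[].
Qed.

Section Usco.
Variables (R : realType) (X : topologicalType).
Implicit Types Phi Psi : X -> set R.

(** All three properties come from [compact_chain_subset] applied to the values
    at a point: with [W] empty it gives non-emptiness, and with [W] open it says
    that upper semicontinuity is witnessed by one member of the chain. *)
Lemma usco_bigcap (C : set (X -> set R)) :
    C !=set0 -> C `<=` @usco R X ->
    (forall Phi Psi, C Phi -> C Psi ->
       (forall x, Phi x `<=` Psi x) \/ (forall x, Psi x `<=` Phi x)) ->
  usco (fun x => \bigcap_(Phi in C) Phi x).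
Proof.
move=> C0 Cu chainC.
have sub x W : open W -> \bigcap_(Phi in C) Phi x `<=` W ->
    exists2 Phi, C Phi & Phi x `<=` W.
  move=> oW; apply: compact_chain_subset => //.
  - by move=> Phi /Cu[_ /(_ x)].
  - by move=> Phi Psi CPhi /(chainC _ _ CPhi)[] /(_ x); [left|right].
split=> [x|x|W oW].
- apply: contrapT => /set0P/negP/negPn/eqP cap0.
  have [|Phi /Cu[/(_ x)[y Phiy] _ _]] := sub x set0 open0.
    by rewrite cap0.
  by move=> /(_ y Phiy).
- have [Phi CPhi] := C0; have [_ /(_ x) cPhi _] := Cu _ CPhi.
  apply: subclosed_compact cPhi _; last by move=> y; apply.
  apply: closed_bigI => Psi /Cu[_ /(_ x) cPsi _].
  by apply: compact_closed cPsi; exact: norm_hausdorff.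
- rewrite openE => x /= /(sub _ _ oW)[Phi CPhi PhiW].
  have [_ _ /(_ W oW) oPhi] := Cu _ CPhi.
  rewrite /interior; apply: filterS (open_nbhs_nbhs (conj oPhi PhiW)).
  by move=> y PhiyW z; move/(_ Phi CPhi); exact: PhiyW.
Qed.

(** Zorn's lemma for the usco maps below [Phi], ordered by reverse inclusion. *)
Lemma exists_minimal_usco Phi :
  usco Phi -> exists Psi : MU R X, forall x, Psi x `<=` Phi x.
Proof.
move=> uPhi.
pose T := {Psi : X -> set R | usco Psi /\ forall x, Psi x `<=` Phi x}.
pose ge (s t : T) := `[< forall x, sval t x `<=` sval s x >].
have [| | |[Psi [uPsi PsiPhi]] Psi_min] :=
    @ZL_preorder T (exist _ Phi (conj uPhi (fun x => @subset_refl _ _))) ge.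
- by move=> s; apply/asboolP => x y.
- move=> s t u /asboolP ts /asboolP su; apply/asboolP => x.
  exact: subset_trans (su x) (ts x).
- move=> C totC; have [[s0 Cs0]|C0] := pselect (C !=set0); last first.
    exists (exist _ Phi (conj uPhi (fun x => @subset_refl _ _))) => s Cs.
    by case: C0; exists s.
  pose D := sval @` C.
  have uD : usco (fun x => \bigcap_(Psi in D) Psi x).
    apply: usco_bigcap; first by exists (sval s0), s0.
      by move=> _ [s _ <-]; case: (svalP s).
    move=> _ _ [s Cs <-] [t Ct <-].
    by have [/asboolP|/asboolP] := totC s t Cs Ct; [right|left].
  have DPhi x : \bigcap_(Psi in D) Psi x `<=` Phi x.
    move=> y /(_ (sval s0)) Dy; have [_] := svalP s0; apply.
    by apply: Dy; exists s0.
  exists (exist _ (fun x => \bigcap_(Psi in D) Psi x) (conj uD DPhi)) => s Cs.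
  apply/asboolP => x y /=.
  by apply; exists s.
suff mPsi : minimal_usco Psi by exists (MkMU mPsi).
split=> // Psi' uPsi' sub.
have {}sub x : Psi' x `<=` Psi x by move=> y; exact: (sub (x, y)).
have Psi'Phi x : Psi' x `<=` Phi x by exact: subset_trans (sub x) (PsiPhi x).
have /asboolP/= PsiPsi' :
    ge (exist _ Psi' (conj uPsi' Psi'Phi)) (exist _ Psi (conj uPsi PsiPhi)).
  by apply: Psi_min; apply/asboolP.
by apply/seteqP; split=> -[x y]; [exact: sub|exact: PsiPsi'].
Qed.

(** Minimality is a local property: a usco map that is smaller than [Phi] on [V]
    extends by [Phi] itself to a usco map on the whole space, the result being
    upper semicontinuous because it lies below [Phi]. *)
Lemma minimal_usco_local (Phi : MU R X) Psi (V : set X) : open V ->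
    usco Psi -> (forall x, V x -> Psi x `<=` Phi x) ->
  forall x, V x -> Psi x = Phi x.
Proof.
move=> oV uPsi PsiPhi; case: (MU_minimal Phi) => uPhi minPhi.
pose glued x := if `[< V x >] then Psi x else Phi x.
have gluedV x : V x -> glued x = Psi x by rewrite /glued; case: asboolP.
have gluedPhi x : glued x `<=` Phi x.
  rewrite /glued; case: asboolP => [Vx|_]; first exact: PsiPhi.
  exact: subset_refl.
have uglued : usco glued.
  case: uPsi uPhi => Psi0 cPsi oPsi [Phi0 cPhi oPhi].
  split=> [x|x|W oW]; rewrite ?/glued; first by case: asboolP.
    by case: asboolP.
  rewrite (_ : [set _ | _] = (V `&` [set x | Psi x `<=` W])
      `|` [set x | Phi x `<=` W]).
    by apply: openU; [apply: openI => //; exact: oPsi | exact: oPhi].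
  apply/seteqP; split=> x /=; first by case: asboolP; [left|right].
  move=> [[Vx]|PhiW]; first by case: asboolP.
  by apply: subset_trans PhiW; exact: gluedPhi.
have glued_eq : graph glued = graph Phi.
  by apply: minPhi => // -[x y]; exact: gluedPhi.
move=> x Vx; rewrite -gluedV //; apply/seteqP; split; first exact: gluedPhi.
by move=> y Phiy; have : graph Phi (x, y) by []; rewrite -glued_eq.
Qed.

Lemma minimal_usco_const (c : R) : minimal_usco (fun _ : X => [set c]).
Proof.
split; first split=> [_|_|V _]; first by exists c.
- exact: compact_set1.
- have [Vc|Vc] := pselect (V c).
    rewrite (_ : [set _ | _] = setT); first exact: openT.
    by apply/seteqP; split=> // x _ _ ->.
  rewrite (_ : [set _ | _] = set0); first exact: open0.
  by apply/seteqP; split=> // x /(_ c erefl).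
- move=> Psi [Psi0 _ _] sub; apply/seteqP; split=> // -[x y] yc.
  have [z Pz] := Psi0 x; have zc : z = c := sub (x, z) Pz.
  by rewrite /graph /= (yc : y = c) -zc.
Qed.

Definition MUconst c : MU R X := MkMU (minimal_usco_const c).

(** Gluing [Phi] on [V] to the constant [c] off [closure V], with both kinds of
    values on the boundary, gives a usco map that need not be minimal.  Passing
    to a minimal one below it changes nothing on [S], where
    [minimal_usco_local] applies, nor off [U], where the values are
    singletons. *)
Lemma exists_usco_separating (Phi : MU R X) (S U : set X) (c : R) :
    (exists V, [/\ open V, S `<=` V & closure V `<=` U]) ->
  exists Psi : MU R X, (forall x, S x -> Psi x = Phi x) /\
    (forall x, ~ U x -> Psi x = [set c]).
Proof.
move=> [V [oV SV clVU]]; case: (MU_minimal Phi) => -[Phi0 cPhi oPhi] _.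
pose Xi x := [set y | (closure V x /\ Phi x y) \/ (~ V x /\ y = c)].
have uXi : usco Xi.
  split=> [x|x|W oW].
  - have [Vx|nVx] := pselect (V x); last by exists c; right.
    have [y Phiy] := Phi0 x; exists y; left.
    by split=> //; exact: subset_closure.
  - have [clx|nclx] := pselect (closure V x).
      have [Vx|nVx] := pselect (V x).
        rewrite (_ : Xi x = Phi x) //; apply/seteqP; split=> y; last by left.
        by case=> -[].
      rewrite (_ : Xi x = Phi x `|` [set c]).
        by apply: compactU => //; exact: compact_set1.
      by apply/seteqP; split=> y [];[case; left|case; right|left|right].
    have nVx : ~ V x by move=> /subset_closure.
    rewrite (_ : Xi x = [set c]); first exact: compact_set1.
    by apply/seteqP; split=> y; [case=> -[]|right].
  - have [Wc|nWc] := pselect (W c).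
      rewrite (_ : [set _ | _] = [set x | Phi x `<=` W] `|` ~` closure V).
        apply: openU; first exact: oPhi.
        exact/closed_openC/closed_closure.
      apply/seteqP; split=> x /=.
        move=> XiW; have [clx|] := pselect (closure V x); last by right.
        by left=> y Phiy; apply: XiW; left.
      by move=> PW y [[clx Phiy]|[_ ->//]]; case: PW => // /(_ y Phiy).
    rewrite (_ : [set _ | _] = V `&` [set x | Phi x `<=` W]).
      by apply: openI => //; exact: oPhi.
    apply/seteqP; split=> x /=.
      move=> XiW; have Vx : V x.
        by apply: contrapT => nVx; apply: nWc; apply: XiW; right.
      by split=> // y Phiy; apply: XiW; left; split=> //; exact: subset_closure.
    by move=> [Vx PhiW] y [[_ /PhiW]|[]].
have [Psi PsiXi] := exists_minimal_usco uXi.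
have [[Psi0 _ _] _] := MU_minimal Psi.
exists Psi; split=> [x /SV Vx|x nUx].
  apply: (minimal_usco_local oV) Vx; first by case: (MU_minimal Psi).
  by move=> z Vz y /PsiXi[[]|[]].
have nclx : ~ closure V x by move=> /clVU.
have Psic y : Psi x y -> y = c by move=> /PsiXi[[]|[]].
apply/seteqP; split=> y; first exact: Psic.
by have [z Psiz] := Psi0 x; move=> ->; rewrite -(Psic z).
Qed.

End Usco.

(** * The topology of uniform convergence on the members of an ideal *)

Section MUTopology.
Variables (R : realType) (X : topologicalType) (A : closed_ideal X).
Implicit Types (Phi Psi : MU R X) (S : set X).

Lemma MU_nbhd_refl Phi S (e : R) : 0 < e -> MU_nbhd Phi S e Phi.
Proof.
by move=> e0 x _; split=> y Phiy; exists y => //; rewrite subrr normr0.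
Qed.

Lemma MU_nbhd_trans Phi Psi S (d e : R) :
  MU_nbhd Phi S d Psi -> MU_nbhd Psi S e `<=` MU_nbhd Phi S (d + e).
Proof.
move=> PhiPsi Theta PsiTheta x Sx.
have [PhiPsi1 PhiPsi2] := PhiPsi x Sx.
have [PsiTheta1 PsiTheta2] := PsiTheta x Sx.
split=> y => [/PhiPsi1[z /PsiTheta1[w Tw zw] yz]|
              /PsiTheta2[z /PhiPsi2[w Pw zw] yz]]; exists w => //.
    by apply: (le_lt_trans (ler_distD z y w)); exact: ltrD.
by rewrite (addrC d); apply: (le_lt_trans (ler_distD z _ _)); exact: ltrD.
Qed.

(** The basic sets need not be open, but the triangle inequality puts [Phi] in
    the interior of [MU_nbhd Phi S e]. *)
Lemma nbhs_MU_nbhd Phi S (e : R) : ideal_sets A S -> 0 < e ->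
  nbhs (Phi : MUspace R A) (MU_nbhd Phi S e).
Proof.
move=> AS e0; rewrite nbhsE.
exists [set Psi | exists2 d : R, 0 < d & MU_nbhd Psi S d `<=` MU_nbhd Phi S e].
  split; last by exists e.
  rewrite open_MUspaceE; right=> Psi [d d0 sub].
  exists S, (d / 2); split=> //; first by rewrite divr_gt0.
  move=> Theta PsiTheta; exists (d / 2); first by rewrite divr_gt0.
  apply: subset_trans sub.
  by have := MU_nbhd_trans PsiTheta (e := d / 2); rewrite -splitr.
by move=> Psi [d d0] sub; apply/sub/MU_nbhd_refl.
Qed.

(** The point [x0] excludes the empty space, where the ideal has no member and
    the whole space is still a neighbourhood. *)
Lemma nbhs_MUspaceP (x0 : X) Phi (N : set (MUspace R A)) :
  nbhs (Phi : MUspace R A) N <->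
  exists S (e : R), [/\ ideal_sets A S, 0 < e & MU_nbhd Phi S e `<=` N].
Proof.
split=> [|[S [e [AS e0]]]]; last first.
  by move=> sub; apply: filterS sub _; exact: nbhs_MU_nbhd.
rewrite nbhsE => -[G [oG GPhi] GN].
have [S [e [AS e0 sub]]] := (MU_open_inhab A G x0).1 oG Phi GPhi.
by exists S, e; split=> //; exact: subset_trans GN.
Qed.

(** Two compact sets at Hausdorff distance zero are equal. *)
Lemma MU_eq Phi Psi :
  (forall x (e : R), 0 < e -> MU_nbhd Phi [set x] e Psi) -> Phi = Psi.
Proof.
move=> close; have PhiPsi : Phi = Psi :> (X -> set R).
  have approx (K : set R) y : compact K ->
      (forall e : R, 0 < e -> exists2 z, K z & `|y - z| < e) -> K y.
    move=> cK near_y; apply: (compact_closed (@norm_hausdorff _ R) cK).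
    move=> N /nbhs_ballP[e /= e0 eN]; have [z Kz yz] := near_y e e0.
    by exists z; split=> //; exact: eN.
  apply/funext => x; apply/seteqP; split=> y Py; apply: approx.
  - by case: (MU_minimal Psi) => -[_ + _] _; apply.
  - by move=> e e0; have [+ _] := close x e e0 x erefl; apply.
  - by case: (MU_minimal Phi) => -[_ + _] _; apply.
  - by move=> e e0; have [_ +] := close x e e0 x erefl; apply.
case: Phi Psi PhiPsi {close} => [f mf] [g mg] /= fg.
by case: _ / fg in mg *; congr MkMU; exact: Prop_irrelevance.
Qed.

Lemma accessible_MUspace : accessible_space (MUspace R A).
Proof.
move=> Phi Psi /eqP PhiPsi.
have [x [e e0 far]] :
    exists x, exists2 e : R, 0 < e & ~ MU_nbhd Phi [set x] e Psi.
  apply: contrapT => close; apply: PhiPsi; apply: MU_eq => x e e0.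
  by apply: contrapT => far; apply: close; exists x, e.
have := nbhs_MU_nbhd Phi (ideal_set1 A x) e0.
rewrite nbhsE => -[G [oG GPhi] sub]; exists G; split=> //; first exact/mem_set.
by apply/mem_set => /sub.
Qed.

Lemma MU_nbhd_const S (c e : R) :
  `|c| < e -> MU_nbhd (MU0 R X) S e (MUconst X c).
Proof.
move=> ce x _; split=> y /= ->; [exists c|exists 0] => //.
  by rewrite sub0r normrN.
by rewrite subr0.
Qed.

Lemma MU_nbhd_const_far S (c e : R) : S !=set0 -> e <= `|c| ->
  ~ MU_nbhd (MU0 R X) S e (MUconst X c).
Proof.
move=> [x Sx] ec /(_ x Sx)[/(_ 0 erefl)[_ /= ->]].
by rewrite sub0r normrN ltNge ec.
Qed.

(** Were there infinitely many, the corresponding points of [S] would have a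
    subsequence converging to some [z]; [Theta] is bounded near [z], whereas the
    values [n] tend to infinity. *)
Lemma finite_near_diverging_values (Theta : MU R X) (S : set X)
    (Psi : nat -> MU R X) (x : nat -> X) : sequentially_compact S ->
    (forall n, S (x n)) -> (forall n, Psi n (x n) = [set n%:R]) ->
  finite_set [set n | MU_nbhd Theta S 1 (Psi n)].
Proof.
move=> seqS Sx Psix; apply: contrapT => infD.
have /choice[g gP] : forall N, exists n,
    (N <= n)%N /\ MU_nbhd Theta S 1 (Psi n).
  move=> N; apply: contrapT => gN; apply: infD.
  apply: (@sub_finite_set _ _ `I_N); last exact: finite_II.
  move=> n /= Dn; rewrite ltnNge; apply/negP => Nn.
  by apply: gN; exists n.
have [phi [phi_incr [z Sz xz]]] := seqS (x \o g) (fun n => Sx (g n)).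
have phi_ge k : (k <= phi k)%N.
  elim: k => // k IHk; apply: leq_ltn_trans IHk _.
  by rewrite (leqW_mono phi_incr).
have [[_ cTheta oTheta] _] := MU_minimal Theta.
have [M [_ /(_ (M + 1))]] := compact_bounded (cTheta z).
rewrite ltrDl ltr01 => /(_ erefl) ThetaM.
pose W : set R := ball 0 (M + 2).
have oW : open W by exact: ball_open.
have ThetaW : Theta z `<=` W.
  move=> y /ThetaM yM; rewrite /W /ball /= sub0r normrN.
  by apply: le_lt_trans yM _; rewrite ltrD2l ltr1n.
have [K _ KW] := xz _ (open_nbhs_nbhs (conj (oTheta W oW) ThetaW)).
(* Past K the values of Theta along the subsequence have modulus below M + 2,
   while those of Psi, within 1 of them, tend to infinity. *)
pose k := maxn K (Num.bound `|M + 3|).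
have [_ Dk] := gP (phi k).
have [_ near_k] := Dk _ (Sx (g (phi k))).
have [|y Thetay gy] := near_k (g (phi k))%:R; first by rewrite Psix.
have : W y by apply: (KW k) Thetay; exact: leq_maxl.
rewrite /W /ball /= sub0r normrN => yM.
suff : (g (phi k))%:R < (g (phi k))%:R :> R by rewrite ltxx.
apply: (@lt_le_trans _ _ (Num.bound `|M + 3|)%:R); last first.
  rewrite ler_nat; apply: leq_trans (leq_maxr K _) _.
  by apply: leq_trans (phi_ge k) _; case: (gP (phi k)).
apply: lt_trans (archi_boundP (normr_ge0 _)).
apply: lt_le_trans (ler_norm _).
have -> : M + 3 = 1 + (M + 2) by rewrite addrCA -natr1E.
rewrite -(subrK y (g (phi k))%:R).
by apply: ltrD; apply: le_lt_trans (ler_norm _) _.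
Qed.


End MUTopology.

(** In a T1 space a neighbourhood meeting [D] in a finite set can be shrunk to
    one that meets [D] at most in its centre. *)
Lemma closed_discrete_locally_finite (T : topologicalType) (D : set T) :
    accessible_space T ->
    (forall z : T, exists2 W, nbhs z W & finite_set (W `&` D)) ->
  closed_discrete T D.
Proof.
move=> T1 lf.
have sep (z : T) : exists2 W, nbhs z W & W `&` D `<=` [set z].
  have [W Wz fWD] := lf z.
  have cE : closed ((W `&` D) `\ z).
    by apply: (accessible_finite_set_closed.1 T1); exact: finite_setD.
  exists (W `&` ~` ((W `&` D) `\ z)).
    apply: filterI => //; apply: open_nbhs_nbhs.
    split; first exact: closed_openC.
    by move=> [_]; exact.
  move=> y [[Wy nEy] Dy]; apply: contrapT => yz; apply: nEy.
  by split.
split=> z.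
  have [W Wz WDz] := sep z; move=> /(_ W Wz)[y [Dy Wy]].
  by rewrite -(WDz y).
move=> Dz; split; first exact/mem_set.
have [W Wz WDz] := sep z; exists W => //; apply/seteqP; split=> // y ->.
by split=> //; exact: nbhs_singleton.
Qed.

(** * Covers relative to an ideal *)

Section Covers.
Variables (X : topologicalType) (A : closed_ideal X).

Lemma ideal_exists_notin (S : set X) :
  ideal_sets A S -> exists x, ~ S x.
Proof.
move=> AS; apply: contrapT => nS; apply: (@ideal_proper X A).
rewrite (_ : setT = S) //; apply/seteqP; split=> // x _.
by apply: contrapT => nSx; apply: nS; exists x.
Qed.

(** If only finitely many members of a cover contained [S], then adding to [S] a
    point outside each of them would give a member of the ideal that no element
    of the cover contains. *)
Lemma large_covers_ideal_covers : large_covers A = ideal_covers A.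
Proof.
apply/seteqP; split=> [C []//|C coverC]; split=> // S AS.
case: coverC => oC _ _ CT coverC finC.
have [T AT [ST TC]] : exists2 T, ideal_sets A T & S `<=` T /\
    forall U, C U -> S `<=` U -> ~ T `<=` U.
  have [s Es] := (finite_seqP _).1 finC.
  have sC U : U \in s -> C U /\ S `<=` U.
    by move=> Us; have : [set` s] U by []; rewrite -Es.
  have [T [AT ST TU]] : exists T, [/\ ideal_sets A T, S `<=` T &
      forall U, U \in s -> ~ T `<=` U].
    elim: s sC {Es} => [|U s IHs] sC.
      by exists S; split=> //; exact: subset_refl.
    have [|T [AT ST TU]] := IHs.
      by move=> V Vs; apply: sC; rewrite inE Vs orbT.
    have [CU SU] := sC U (mem_head _ _).
    have [x nUx] : exists x, ~ U x.
      apply: contrapT => nU; apply: CT; rewrite (_ : setT = U) //.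
      apply/seteqP; split=> // x _; apply: contrapT => nUx.
      by apply: nU; exists x.
    exists (T `|` [set x]); split.
    - by apply: ideal_setU => //; exact: ideal_set1.
    - by move=> y /ST; left.
    - move=> V; rewrite inE => /predU1P[->|/TU nTV] TxV.
        by apply: nUx; apply: TxV; right.
      by apply: nTV => y Ty; apply: TxV; left.
  exists T => //; split=> // U CU SU; apply: TU.
  by have : [set U | C U /\ S `<=` U] U by []; rewrite Es.
have [U CU TU] := coverC T AT.
by apply: (TC U CU) => //; exact: subset_trans TU.
Qed.

Lemma ideal_cover_frequently (U : nat -> set X) (S : set X) (N : nat) :
    ideal_covers A (range U) -> ideal_sets A S ->
  exists2 n, (N <= n)%N & S `<=` U n.
Proof.
rewrite -large_covers_ideal_covers => -[_ largeU] AS.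
apply: contrapT => small; apply: (largeU S AS).
apply: (@sub_finite_set _ _ (U @` `I_N)); last exact/finite_image/finite_II.
move=> _ [[n _ <-] SUn]; exists n => //=; rewrite ltnNge; apply/negP => Nn.
by apply: small; exists n.
Qed.

End Covers.

(** * The cycle of comparisons *)

Section GameComparisons.
Variables (R : realType) (X : topologicalType) (A B : closed_ideal X).

(** The constant maps with small values show that 0 is not isolated. *)
Lemma proper_opens_setD0 (U : set (MUspace R A)) :
  proper_opens (MUspace R A) U -> proper_opens (MUspace R A) (U `\ MU0 R X).
Proof.
case=> oU [Phi UPhi] UT; split.
- apply: openI => //; apply: closed_openC.
  exact: accessible_closed_set1 (@accessible_MUspace R X A) _.
- have [Phi0|Phi0] := pselect (Phi = MU0 R X); last by exists Phi.
  case: oU => [//|/(_ _ UPhi)[S [e [AS e0 sub]]]].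
  rewrite Phi0 in sub; have e20 : 0 < e / 2 by rewrite divr_gt0.
  exists (MUconst X (e / 2)); split.
    apply: sub; apply: MU_nbhd_const; rewrite gtr0_norm //.
    by rewrite ltr_pdivrMr // ltr_pMr // ltr1n.
  move=> const0; have far := @MU_nbhd_const_far R X S (e / 2) (e / 2).
  apply: far; [exact: ideal_nonempty AS | exact: ler_norm|].
  by rewrite const0; exact: MU_nbhd_refl.
- move=> UD; have : (U `\ MU0 R X) (MU0 R X) by rewrite UD.
  by case=> _; apply.
Qed.

Lemma closed_discrete_le_opens_notOmega :
  game_le_II
    (@G1 (MU R X) (proper_opens (MUspace R A)) (closed_discrete (MUspace R B)))
    (@G1 (MU R X) (proper_opens (MUspace R A))
                  (~` Omega_at (MUspace R B) (MU0 R X))).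
Proof.
apply: (game_le_II_of_answers (MU0 R X)
  (answer := fun _ Phi Psi => Psi = Phi /\ Phi <> MU0 R X)).
  move=> _ U oU; exists (U `\ MU0 R X); first exact: proper_opens_setD0.
  by move=> Phi [UPhi Phi0]; exists Phi.
move=> Phi Psi ans [clD _] cl0.
have PsiPhi : Psi = Phi by apply/funext => n; case: (ans n).
rewrite PsiPhi in cl0; have [n _ Phin] := clD _ cl0.
by have [_] := ans n; apply.
Qed.

Lemma opens_notOmega_le_nbhs_notOmega :
  game_le_II
    (@G1 (MU R X) (proper_opens (MUspace R A))
                  (~` Omega_at (MUspace R B) (MU0 R X)))
    (@G1 (MU R X) (proper_opens_at (MUspace R A) (MU0 R X))
                  (~` Omega_at (MUspace R B) (MU0 R X))).
Proof. by apply: (game_le_II_same (MU0 R X)) => [U []|]. Qed.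

Lemma nbhs_notOmega_le_covers :
  game_le_II
    (@G1 (MU R X) (proper_opens_at (MUspace R A) (MU0 R X))
                  (~` Omega_at (MUspace R B) (MU0 R X)))
    (G1 (proper_opens_over_members A) (~` ideal_covers B)).
Proof.
pose answer n (Phi : MU R X) (U : set X) := proper_opens X U /\
  forall x, U x -> forall y, Phi x y -> `|y| < n.+1%:R^-1 :> R.
apply: (game_le_II_of_answers set0 (answer := answer)).
  move=> n _ [S AS <-]; set e : R := n.+1%:R^-1.
  have e0 : 0 < e by rewrite invr_gt0.
  have := nbhs_MU_nbhd (MU0 R X) AS e0; rewrite nbhsE => -[G [oG G0] Gsub].
  exists G.
    split=> //; split=> //; first by exists (MU0 R X).
    move=> GT; have : G (MUconst X e) by rewrite GT.
    move=> /Gsub; apply: MU_nbhd_const_far; last exact: ler_norm.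
    exact: ideal_nonempty AS.
  move=> Phi /Gsub PhiS; have [z nSz] := ideal_exists_notin AS.
  have [[_ _ oPhi] _] := MU_minimal Phi.
  (* Without the removal of z the answer could be the whole space. *)
  pose U := [set x | Phi x `<=` ball (0 : R) e] `&` ~` [set z].
  have UP x y : U x -> Phi x y -> `|y| < e.
    by case=> + _ => /[apply]; rewrite /ball /= sub0r normrN.
  have oU : open U.
    apply: openI; first by apply: oPhi; exact: ball_open.
    by apply: closed_openC; exact: ideal_closed (ideal_set1 A z).
  have SU : S `<=` U.
    move=> x Sx; split; last by move=> xz; apply: nSz; rewrite -xz.
    move=> y /(PhiS x Sx).2[_ -> ]; rewrite subr0 /ball /= sub0r.
    by rewrite normrN.
  have pU : proper_opens X U.
    split=> //; first by have [x /SU] := ideal_nonempty AS; exists x.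
    move=> UT; have : U z by rewrite UT.
    by case=> _; apply.
  exists U; first by split.
  by split=> // x Ux y; exact: UP.
move=> Phi U ans nOmega coverU; apply: nOmega => N.
have [[_ [x0 _] _] _] := ans 0%N.
move=> /(nbhs_MUspaceP x0)[S [e [BS e0 sub]]].
(* Infinitely many answers contain S, so one of them comes from a round late
   enough for its bound to be below e. *)
pose N0 := Num.bound e^-1.
have [n N0n SU] := ideal_cover_frequently N0 coverU BS.
have ne : n.+1%:R^-1 < e.
  rewrite invf_plt ?posrE //; apply: lt_trans (archi_boundP _) _.
    by rewrite invr_ge0 ltW.
  by rewrite ltr_nat ltnS.
exists (Phi n); split; first by exists n.
apply: sub => x /SU Ux; have [_ /(_ x Ux) small] := ans n.
have [[Phi0 _ _] _] := MU_minimal (Phi n).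
split=> [_ /= ->|y /small ylt]; last first.
  by exists 0; rewrite ?subr0 ?(lt_trans ylt).
have [y Py] := Phi0 x; exists y => //.
by rewrite sub0r normrN (lt_trans (small y Py)).
Qed.

Lemma covers_le_large_covers :
  game_le_II (G1 (proper_opens_over_members A) (~` ideal_covers B))
             (G1 (proper_opens_over_members A) (~` large_covers B)).
Proof.
by apply: (game_le_II_same set0) => //; rewrite large_covers_ideal_covers.
Qed.

Lemma large_covers_le_closed_discrete :
    ideal_normal A ->
    (forall S : set X, ideal_sets B S -> sequentially_compact S) ->
  game_le_II
    (G1 (proper_opens_over_members A) (~` large_covers B))
    (@G1 (MU R X) (proper_opens (MUspace R A)) (closed_discrete (MUspace R B))).
Proof.
move=> normalX seqcompactB.
pose answer n (U : set X) (Psi : MU R X) := proper_opens X U /\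
  forall x, ~ U x -> Psi x = [set n%:R : R].
apply: (game_le_II_of_answers (MU0 R X) (answer := answer)).
  move=> n O' [oO [Phi OPhi] OT].
  case: oO => [//|/(_ _ OPhi)[S [e [AS e0 sub]]]].
  exists (proper_opens_over X S); first by exists S.
  move=> U [pU SU]; have [oU _ _] := pU.
  have [Psi [PsiS PsiU]] :=
    exists_usco_separating Phi n%:R (normalX _ _ AS oU SU).
  exists Psi; last by split.
  apply: sub => x Sx; rewrite (PsiS x Sx).
  exact: (@MU_nbhd_refl _ _ Phi S e).
move=> U Psi ans; rewrite large_covers_ideal_covers => ncover.
have [T BT nTU] : exists2 T, ideal_sets B T & forall n, ~ T `<=` U n.
  apply: contrapT => sub; apply: ncover.
  have coverU S : ideal_sets B S -> exists2 V, range U V & S `<=` V.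
    move=> BS; apply: contrapT => nS; apply: sub; exists S => // n SU.
    by apply: nS; exists (U n).
  split=> //.
  - by move=> _ [n _ <-]; case: (ans n) => -[].
  - apply/seteqP; split=> // x _.
    by have [V UV xV] := coverU _ (ideal_set1 B x); exists V => //; exact: xV.
  - by move=> [n _ Un]; case: (ans n) => -[_]; rewrite Un => -[].
  - by move=> [n _ Un]; case: (ans n) => -[].
have /choice[x xP] : forall n, exists x, T x /\ ~ U n x.
  move=> n; apply: contrapT => nx; apply: (nTU n) => x Tx.
  by apply: contrapT => nUx; apply: nx; exists x.
apply: closed_discrete_locally_finite; first exact: accessible_MUspace.
move=> Theta; exists (MU_nbhd Theta T 1); first exact: nbhs_MU_nbhd.
have finD : finite_set [set n | MU_nbhd Theta T 1 (Psi n)].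
  apply: finite_near_diverging_values (seqcompactB _ BT)
    (fun n => (xP n).1) _ => n.
  by have [_] := ans n; apply; case: (xP n).
apply: sub_finite_set (finite_image Psi finD).
by move=> Psi_n [+ [n _ Psin]]; rewrite -Psin => near_n; exists n.
Qed.

End GameComparisons.

Theorem theorem39 (R : realType) (X : topologicalType) (A B : closed_ideal X)
    (normalX : ideal_normal A)
    (seqcompactB : forall S : set X, ideal_sets B S -> sequentially_compact S) :
  game_le_II
    (G1 (proper_opens_over_members A) (~` large_covers B))
    (@G1 (MU R X) (proper_opens (MUspace R A)) (closed_discrete (MUspace R B)))
  /\
  [/\ game_equiv
        (G1 (proper_opens_over_members A) (~` ideal_covers B))
        (@G1 (MU R X) (proper_opens_at (MUspace R A) (MU0 R X))
                      (~` Omega_at (MUspace R B) (MU0 R X))),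
      game_equiv
        (@G1 (MU R X) (proper_opens_at (MUspace R A) (MU0 R X))
                      (~` Omega_at (MUspace R B) (MU0 R X)))
        (@G1 (MU R X) (proper_opens (MUspace R A))
                      (~` Omega_at (MUspace R B) (MU0 R X))) &
      game_equiv
        (@G1 (MU R X) (proper_opens (MUspace R A))
                      (~` Omega_at (MUspace R B) (MU0 R X)))
        (@G1 (MU R X) (proper_opens (MUspace R A))
                      (closed_discrete (MUspace R B)))].
Proof.
have large_discrete :=
  @large_covers_le_closed_discrete R X A B normalX seqcompactB.
have discrete_opens := @closed_discrete_le_opens_notOmega R X A B.
have opens_nbhs := @opens_notOmega_le_nbhs_notOmega R X A B.
have nbhs_covers := @nbhs_notOmega_le_covers R X A B.
have covers_discrete :=
  game_le_II_trans (@covers_le_large_covers X A B) large_discrete.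
split=> //; split; apply: game_equiv_le_II => //.
- exact: game_le_II_trans covers_discrete
    (game_le_II_trans discrete_opens opens_nbhs).
- exact: game_le_II_trans nbhs_covers
    (game_le_II_trans covers_discrete discrete_opens).
- exact: game_le_II_trans opens_nbhs
    (game_le_II_trans nbhs_covers covers_discrete).
Qed.
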